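(* Let $A$ be a $d\times n$ integer matrix ($n>d$) whose $d\times d$ minors are relatively prime, let $\theta\in\mathbb{N}\mathcal{A}$ be a smooth degree, let $\mathcal{H}=\mathcal{H}(\mathcal{B},\psi)$ be the associated affine hyperplane arrangement in $\mathbb{R}^{n-d}$, and let $F_1,\dots,F_r$ be the $(n-d)$-dimensional cells of its bounded complex $\mathcal{H}^{bd}$. For $1\le i,j\le r$ set $\sigma_{ij}=\overline{F_i}\cap\overline{F_j}$ and $$\Phi(F_i,F_j)=(-1)^{\dim\sigma_{ij}}\,\bigl|\{\text{vertices } v: v\in\sigma_{ij}\}\bigr|.$$ Then for all $i,j$, $$\Phi(F_i,F_j)=(-1)^{n-d}\,\langle\Psi(F_i),\Psi(F_j)\rangle,$$ where $\Psi(F_i)=\sum_{v\in\partial F_i}\Psi(v)\in C_{n-d-1}(\mathcal{N})$ and $\langle\cdot,\cdot\rangle$ is the inner product on the simplicial chains of $\mathcal{N}$ for which the simplices form an orthonormal basis.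
   Context: Let $A=[a_1,\dots,a_n]$ be a $d\times n$ integer matrix whose $d\times d$ minors are relatively prime, with columns $\mathcal{A}=\{a_1,\dots,a_n\}\subset\mathbb{Z}^d$; $\mathbb{N}\mathcal{A}$ denotes the semigroup of non-negative integer combinations of the $a_i$. A degree $\theta\in\mathbb{N}\mathcal{A}$ is generic if it lies in no linear subspace of $\mathbb{R}^d$ spanned by fewer than $d$ of the $a_i$; it is a smooth degree if it is generic and every $d\times d$ submatrix of $A$ whose columns form a basis of $\mathbb{R}^d$ has determinant $\pm1$. Choose an $n\times(n-d)$ integer matrix $B$ with rows $b_1,\dots,b_n$ such that $0\to\mathbb{Z}^{n-d}\xrightarrow{B}\mathbb{Z}^n\xrightarrow{A}\mathbb{Z}^d\to0$ is exact, put $\mathcal{B}=\{b_1,\dots,b_n\}$, and choose $\psi\in\mathbb{Z}^n$ with $A\psi=\theta$. The arrangement $\mathcal{H}(\mathcal{B},\psi)$ consists of the affine hyperplanes $\{x\in\mathbb{R}^{n-d}:b_i\cdot x+\psi_i=0\}$ (those with $b_i=0$ are empty and are discarded); denote them $H_1,\dots,H_s$. Since $\theta$ is generic, a set of these hyperplanes has non-empty intersection if and only if the corresponding $b_i$ are linearly independent. The arrangement subdivides $\mathbb{R}^{n-d}$ into relatively open polyhedral cells; $\mathcal{H}^{bd}$ is the polyhedral complex of all bounded cells, and $F_1,\dots,F_r$ are its (open) cells of dimension $n-d$. Vertices are the $0$-dimensional cells. If $\sigma_{ij}=\emptyset$ then $\Phi(F_i,F_j)=0$. $\mathcal{N}$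 is the simplicial complex with vertices $v_1,\dots,v_s$ in which $\{v_{i_1},\dots,v_{i_k}\}$ is a simplex if and only if $H_{i_1}\cap\dots\cap H_{i_k}\neq\emptyset$, equivalently if and only if the vectors of $\mathcal{B}$ corresponding to these hyperplanes are linearly independent (the independence complex of the matroid $M(\mathcal{B})$; it is also the nerve of the cover of $\mathcal{H}^{bd}\setminus\bigcup_jF_j$ by its intersections with the $H_i$). It has dimension $n-d-1$. The chain group $C_\star(\mathcal{N})$ carries the inner product for which the chains $[\Delta]$, $\Delta$ a simplex of $\mathcal{N}$ (with one fixed orientation for each), are an orthonormal basis. For $F=F_i$ and each hyperplane incident to $F$ choose the normal pointing inward to $F$. For a vertex $v$ of $\partial F$, exactly $n-d$ hyperplanes $H_{i_1},\dots,H_{i_{n-d}}$ contain $v$; let $\eta_{i_1},\dots,\eta_{i_{n-d}}$ be their inward normals with respect to $F$, and set $\Psi(v)=\mathrm{sign}\det(\eta_{i_1},\dots,\eta_{i_{n-d}})\,[v_{i_1},\dots,v_{i_{n-d}}]$, an oriented simplex of $\mathcal{N}$ (independent of the ordering of the hyperplanes, but depending on $F$). Then $\Psi(F)=\Psi[F]=\sum_{v\in\partial F}\Psi(v)$, summed over all vertices $v$ of $F$. *)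

(* Defs.v *)
From HB Require Import structures.
From mathcomp Require Import all_boot all_order all_algebra all_fingroup.
From mathcomp Require Import finmap.
From mathcomp Require Import all_classical all_reals all_analysis.

Set Implicit Arguments.
Unset Strict Implicit.
Unset Printing Implicit Defensive.

Import Order.TTheory GRing.Theory Num.Theory.
Import numFieldNormedType.Exports.

Local Open Scope classical_set_scope.
Local Open Scope ring_scope.

Section Degrees.

Variables (d n : nat).
Implicit Types (A : 'M[int]_(d, n)) (theta : 'cV[int]_d).

(* A column selection f that is not injective contributes \det = 0, which is
   neutral for gcdn, and reordering columns only changes the sign of \det. *)
Definition coprime_maximal_minors A : Prop :=
  \big[gcdn/0%N]_(f : {ffun 'I_d -> 'I_n}) `|\det (colsub f A)|%N = 1%N.

Definition in_semigroup A theta : Prop :=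
  exists c : 'I_n -> nat, theta = \sum_j col j A *+ c j.

Definition generic_degree (R : realType) A theta : Prop :=
  in_semigroup A theta /\
  forall J : {set 'I_n}, (#|J| < d)%N ->
    ~ exists c : 'I_n -> R,
        map_mx intr theta = \sum_(j in J) c j *: map_mx intr (col j A).

Definition columns_form_basis (R : realType) (M : 'M[int]_d) : bool :=
  basis_of fullv [seq (map_mx intr (col k M) : 'cV[R]_d) | k : 'I_d].

Definition smooth_degree (R : realType) A theta : Prop :=
  generic_degree R A theta /\
  forall f : {ffun 'I_d -> 'I_n},
    columns_form_basis R (colsub f A) ->
    \det (colsub f A) = 1 \/ \det (colsub f A) = -1.

(* 0 -> Z^m --B--> Z^n --A--> Z^d -> 0 *)
Definition short_exact m (B : 'M[int]_(n, m)) A : Prop :=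
  [/\ injective (fun x : 'cV[int]_m => B *m x),
      forall y : 'cV[int]_n,
        A *m y = 0 <-> exists x : 'cV[int]_m, y = B *m x
    & forall z : 'cV[int]_d, exists y : 'cV[int]_n, A *m y = z].

End Degrees.

Section AffineDimension.

Variables (R : realType) (m : nat).

(* The largest k such that S contains k + 1 affinely independent points
   (0 for S = set0). *)
Definition affine_dim (S : set 'cV[R]_m) : nat :=
  \max_(k < m.+1 | `[< exists (x0 : 'cV[R]_m) (x : 'I_k -> 'cV[R]_m),
      [/\ S x0, forall j, S (x j) & free [seq x j - x0 | j : 'I_k]] >]) k.

End AffineDimension.

Section Arrangement.

Variables (R : realType) (n m : nat).
Variables (B : 'M[int]_(n, m)) (psi : 'cV[int]_n).
Implicit Types (i : 'I_n) (x v : 'cV[R]_m) (F S : set 'cV[R]_m).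

(* x |-> b_i . x + psi_i *)
Definition affine_form i x : R := (map_mx intr B *m x + map_mx intr psi) i 0.

Definition hyperplane i : set 'cV[R]_m := [set x | affine_form i x = 0].

(* The hyperplanes of the arrangement are indexed by the nonzero rows of B.
   When psi represents a generic degree, distinct indices give distinct
   hyperplanes, since parallel rows give disjoint ones. *)
Definition hyperplane_index : {set 'I_n} := [set i | row i B != 0].

Definition cell F : Prop :=
  exists x, F = [set y | forall i,
                  Num.sg (affine_form i y) = Num.sg (affine_form i x)].

Definition bounded_complex : set (set 'cV[R]_m) :=
  [set F | cell F /\ bounded_set F].

Definition bounded_chamber : set (set 'cV[R]_m) :=
  [set F | bounded_complex F /\ affine_dim F = m].

(* The 0-dimensional cells, being convex, are the one-point cells. *)
Definition vertices_in S : set 'cV[R]_m := [set v | cell [set v] /\ S v].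

Definition boundary F : set 'cV[R]_m := closure F `\` interior F.

Definition hyperplanes_through v : {set 'I_n} :=
  [set i in hyperplane_index | `[< hyperplane i v >]].

(* A set of hyperplanes is identified with its set of indices. *)
Definition nerve : set {set 'I_n} :=
  [set s | s != finset.set0 /\ s \subset hyperplane_index /\
           exists x, forall i, i \in s -> hyperplane i x].

(* Simplices with p vertices, i.e. of dimension p - 1. *)
Definition simplex (p : nat) : finType :=
  {s : {set 'I_n} | (s \in nerve) && (#|s| == p)}.

(* Integral chains C_(p-1)(N), in coordinates with respect to the basis [Delta]
   given by a choice of one orientation for each simplex. *)
Definition chain (p : nat) := {ffun simplex p -> int}.

(* An orientation is represented by an ordering of the vertices. *)
Definition is_orientation (p : nat) (o : simplex p -> p.-tuple 'I_n) : Prop :=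
  forall s : simplex p, [set i in o s]%SET = val s.

(* The oriented simplex [t_1, ..., t_p]: if t lists the vertices of s, there is
   exactly one permutation g with t = o s \o g, and [t] = sign g * [o s]. *)
Definition oriented_simplex (p : nat) (o : simplex p -> p.-tuple 'I_n)
    (t : p.-tuple 'I_n) : chain p :=
  [ffun s => \sum_(g : 'S_p | [forall k, tnth t k == tnth (o s) (g k)])
               (-1) ^+ (g : bool)].

Definition chain_dot (p : nat) (c c' : chain p) : int := \sum_s c s * c' s.

Definition inward_normal F i : 'cV[R]_m :=
  let b := (row i (map_mx intr B))^T in
  if `[< forall x, F x -> 0 < affine_form i x >] then b else - b.

(* For a generic degree exactly m hyperplanes pass through a vertex, so the
   second branch is not reached there. *)
Definition Psi_vertex (o : simplex m -> m.-tuple 'I_n) F v : chain m :=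
  if insub (enum (hyperplanes_through v)) is Some t then
    oriented_simplex o (t : m.-tuple 'I_n)
      *~ sgz (\det (\matrix_(k, l) inward_normal F (tnth t l) k 0))
  else 0.

(* The set of vertices of the arrangement is finite. *)
Definition Psi (o : simplex m -> m.-tuple 'I_n) F : chain m :=
  \sum_(v <- fset_set (vertices_in (boundary F))) Psi_vertex o F v.

(* For sigma = set0 the second factor is 0. *)
Definition Phi F F' : int :=
  let sigma := closure F `&` closure F' in
  (-1) ^+ affine_dim sigma * (#|` fset_set (vertices_in sigma)|)%:Z.

End Arrangement.

(* Main.v *)
Require Import Defs.
From mathcomp Require Import all_boot all_order all_algebra all_fingroup.
From mathcomp Require Import finmap.
From mathcomp Require Import all_classical all_reals all_analysis.

Set Implicit Arguments.
Unset Strict Implicit.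
Unset Printing Implicit Defensive.

Import Order.TTheory GRing.Theory Num.Theory.
Import numFieldNormedType.Exports.

Local Open Scope ring_scope.

(** Write [ell_i x = b_i . x + psi_i] and [m = n - d].  The proof compares both
    sides through the set [sep] of those hyperplanes that strictly separate the
    chambers [F] and [F'].

    Genericity says that the arrangement is simple: at any point [v] the rows
    [b_i] with [ell_i v = 0] are linearly independent (lemma [generic_simple]).
    Indeed a relation among these rows is an element of the left kernel of [B],
    hence, by exactness, of the form [w A]; and [w] kills every column [a_j] with
    [ell_j v <> 0].  But [theta = A (B v + psi)] is a combination of these columns,
    so by genericity they span the whole space and [w = 0].

    In a simple arrangement exactly [m] hyperplanes pass through a vertex, their
    normals form a basis, and the vertex is determined by them.  So on the chain
    side, [Psi F] is a sum of signed distinct simplices indexed by the vertices of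
    [F], and [<Psi F, Psi F'>] only collects the common vertices.  At such a vertex
    [v] every separating hyperplane passes through [v], because its form is both
    [>= 0] and [<= 0] on the common face.  The two inward frames at [v] thus differ
    by the sign changes of the normals in [sep], and the two determinants by the
    factor [(-1) ^ #sep] (lemma [Psi_dot]).

    On the geometric side, a common face with a vertex [v] is cut out near [v] by
    the equations [ell_i = 0] for [i] in [sep] and one-sided inequalities for the
    other hyperplanes through [v].  These forms are coordinates around [v], so the
    face has dimension [m - #sep] (lemma [affine_dim_common_face]).  Comparing,
    [(-1) ^ (m - #sep) = (-1) ^ m (-1) ^ #sep].  If there is no common vertex, both
    sides vanish. *)

(** * Free families and row rank *)

Section LinearAlgebra.

Variables (F : fieldType) (m : nat).

Lemma free_row_free k (w : 'I_k -> 'cV[F]_m) :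
  free [seq w j | j : 'I_k] = row_free (\matrix_(j, i) w j i 0).
Proof.
have sz : size [seq w j | j : 'I_k] == k by rewrite size_image card_ord.
have E (c : 'I_k -> F) :
    \sum_j c j *: (Tuple sz)`_j = (\row_j c j *m \matrix_(j, i) w j i 0)^T.
  apply/colP => i; rewrite !mxE summxE; apply: eq_bigr => j _.
  by rewrite !mxE /image_mem (nth_map j) ?size_enum_ord // nth_ord_enum.
apply/(freeP (X := Tuple sz))/row_freeP => [fw|[D WD] c].
  apply/row_freeP/inj_row_free => c c0.
  apply/rowP => j; rewrite mxE; apply: (fw (c 0)).
  by rewrite E (_ : \row_j0 c 0 j0 = c) ?c0 ?trmx0 //; apply/rowP => i; rewrite mxE.
rewrite E => /(congr1 trmx); rewrite trmxK trmx0 => /(congr1 (mulmx^~ D)) /=.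
by rewrite -mulmxA WD mulmx1 mul0mx => /rowP c0 j; have := c0 j; rewrite !mxE.
Qed.

Lemma free_kernel_bound k s (w : 'I_k -> 'cV[F]_m) (N : 'M[F]_(s, m)) :
    free [seq w j | j : 'I_k] -> row_free N -> (forall j, N *m w j = 0) ->
  (k + s <= m)%N.
Proof.
rewrite free_row_free /row_free => /eqP rkW /eqP rkN Nw.
rewrite -rkW -rkN -mxrank_tr addnC; apply: mulmx0_rank_max.
apply/matrixP => l j; have /colP/(_ l) := Nw j; rewrite !mxE => Nwl.
by apply: etrans Nwl; apply: eq_bigr => i _; rewrite !mxE.
Qed.

Lemma kernel_vector s (N : 'M[F]_(s, m)) :
  (s < m)%N -> exists2 u : 'cV[F]_m, u != 0 & N *m u = 0.
Proof.
move=> lt_sm.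
have : kermx N^T != 0.
  rewrite kermx_eq0 /row_free mxrank_tr neq_ltn.
  by rewrite (leq_ltn_trans (rank_leq_row N) lt_sm).
case/rowV0Pn => u /sub_kermxP uN u0; exists u^T.
  by apply: contraNneq u0 => /(congr1 trmx); rewrite trmxK trmx0 => ->.
by apply: trmx_inj; rewrite trmx_mul trmxK trmx0.
Qed.

End LinearAlgebra.

(** * Hyperplanes through a point of a simple arrangement *)

Section SimpleArrangement.

Variables (R : realType) (n m : nat).
Variables (B : 'M[int]_(n, m)) (psi : 'cV[int]_n).
Implicit Types (i : 'I_n) (x y u v : 'cV[R]_m).

Notation Bm := (map_mx intr B : 'M[R]_(n, m)).
Notation ell := (affine_form B psi).

(** Linear independence of the rows is phrased with coefficient vectors indexed by
    all rows and supported on the zero set of [v]; this avoids reindexing, and it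
    is the form in which the exact sequence delivers it. *)
Definition simple_arrangement : Prop :=
  forall (v : 'cV[R]_m) (c : 'rV[R]_n),
    c *m Bm = 0 -> (forall i, ell i v != 0 -> c 0 i = 0) -> c = 0.

Lemma affine_formD i v u : ell i (v + u) = ell i v + (Bm *m u) i 0.
Proof. by rewrite /affine_form mulmxDr -addrAC !mxE. Qed.

Lemma affine_formB i v u : (Bm *m (u - v)) i 0 = ell i u - ell i v.
Proof. by rewrite -[in RHS](subrK v u) [u - v + v]addrC affine_formD addrAC subrr add0r. Qed.

Lemma affine_form_segment i y x (t : R) :
  ell i (y + t *: (x - y)) = (1 - t) * ell i y + t * ell i x.
Proof.
rewrite affine_formD -scalemxAr mxE affine_formB mulrBl mul1r mulrBr.
by rewrite addrA addrAC.
Qed.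

(** One step size serves all the hyperplanes that miss [v]: it is chosen so that
    the sum over them of the relative changes of the forms stays below 1. *)
Lemma small_step v u :
  exists2 e : R, 0 < e & forall i, ell i v != 0 ->
    Num.sg (ell i (v + e *: u)) = Num.sg (ell i v).
Proof.
pose S := \sum_i `|(Bm *m u) i 0| / `|ell i v|.
have S0 : 0 <= S by apply: sumr_ge0 => i _; rewrite divr_ge0.
have S1 : 0 < 1 + S by rewrite ltr_wpDr.
exists (1 + S)^-1; first by rewrite invr_gt0.
move=> i li0; rewrite affine_formD -scalemxAr mxE.
have lt : `|(1 + S)^-1 * (Bm *m u) i 0| < `|ell i v|.
  rewrite normrM gtr0_norm ?invr_gt0 // mulrC ltr_pdivrMr // mulrC.
  rewrite -ltr_pdivrMr ?normr_gt0 //.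
  by rewrite ltr_pwDl // /S (bigD1 i) //= lerDl sumr_ge0 // => k _; rewrite divr_ge0.
move: lt; case: (sgrP (ell i v)) li0 => // lv _; rewrite ltr_norml => /andP[lt1 lt2].
  by apply: gtr0_sg; rewrite -(subrr (ell i v)) ltrD2l.
by apply: ltr0_sg; rewrite -(subrr (ell i v)) ltrD2l.
Qed.

Hypothesis simple : simple_arrangement.

Lemma zero_rows_free k (f : 'I_k -> 'I_n) v :
  injective f -> (forall l, ell (f l) v = 0) -> row_free (rowsub f Bm).
Proof.
move=> injf lf0; apply: inj_row_free => c cN.
(* Spreads the coefficients over all rows, with zeros outside the image of f. *)
pose c' := c *m rowsub f 1%:M.
have c'E l : c' 0 (f l) = c 0 l.
  rewrite mxE (bigD1 l) //= !mxE eqxx mulr1 big1 ?addr0 // => k0 nk.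
  by rewrite !mxE (inj_eq injf) (negPf nk) mulr0.
have c'0 : c' = 0.
  apply: (simple (v := v)) => [|i li0].
    by rewrite /c' -mulmxA mul_rowsub_mx mul1mx.
  rewrite mxE big1 // => l _; rewrite !mxE.
  by case: eqP => [fl|]; rewrite ?mulr0 //; rewrite -fl lf0 eqxx in li0.
by apply/rowP => l; rewrite -c'E c'0 !mxE.
Qed.

Lemma zero_row_neq0 i v : ell i v = 0 -> row i B != 0.
Proof.
move=> li0; apply/eqP => ri0.
have : row_free (rowsub (fun _ : 'I_1 => i) Bm).
  by apply: (@zero_rows_free _ _ v) => // a b _; rewrite !ord1.
case/row_freeP => D; rewrite (_ : rowsub _ _ = 0) ?mul0mx => [/matrixP/(_ 0 0)/eqP|].
  by rewrite !mxE eqxx eq_sym oner_eq0.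
by apply/matrixP => a k; rewrite !mxE; have /rowP/(_ k) := ri0; rewrite !mxE => ->.
Qed.

Lemma mem_hyperplanes_through i v :
  (i \in hyperplanes_through B psi v) = (ell i v == 0).
Proof.
rewrite !inE; apply/andP/eqP => [[_ /asboolP //]|li0].
by split; [apply: zero_row_neq0 li0 | apply/asboolP].
Qed.

Lemma hyperplanes_through_row_free v :
  row_free (rowsub (@enum_val _ (mem (hyperplanes_through B psi v))) Bm).
Proof.
apply: (@zero_rows_free _ _ v) => [|l]; first exact: enum_val_inj.
by apply/eqP; rewrite -mem_hyperplanes_through enum_valP.
Qed.

(** Simplicity bounds the number of hyperplanes through any point by [m].  If fewer
    than [m] of them pass through [v], their common direction space is non-zero, and
    a small step along it stays in the cell of [v], which is then not a point. *)
Lemma card_hyperplanes_through v :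
  cell B psi [set v] -> #|hyperplanes_through B psi v| = m.
Proof.
move=> [x0 vE].
have {vE}vE y : (forall i, Num.sg (ell i y) = Num.sg (ell i v)) -> y = v.
  have : [set v]%classic v by [].
  by rewrite vE /= => vx yv; suff : [set v]%classic y by []; rewrite vE => i; rewrite yv.
have rf := hyperplanes_through_row_free v.
apply/eqP; rewrite eqn_leq; apply/andP; split.
  by rewrite -(eqP rf) rank_leq_col.
rewrite leqNgt; apply/negP => /(@kernel_vector R m _ (rowsub enum_val Bm))[u u0 Nu].
have [e e0 he] := small_step v u.
have /vE/eqP : forall i, Num.sg (ell i (v + e *: u)) = Num.sg (ell i v).
  move=> i; have [li0|] := eqVneq (ell i v) 0; last exact: he.
  rewrite affine_formD -scalemxAr mxE li0.
  have iZ : i \in hyperplanes_through B psi v by rewrite mem_hyperplanes_through li0.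
  have /colP/(_ (enum_rank_in iZ i)) := Nu.
  rewrite mul_rowsub_mx mxE enum_rankK_in // => ->.
  by rewrite !mxE mulr0 addr0.
by rewrite -subr_eq0 addrAC subrr add0r scaler_eq0 (gt_eqF e0) (negPf u0).
Qed.

(** The normals at a vertex span, so the hyperplanes through it meet nowhere
    else. *)
Lemma vertex_eq v v' : cell B psi [set v] -> 
  hyperplanes_through B psi v = hyperplanes_through B psi v' -> v = v'.
Proof.
move=> vv Zvv'; apply/eqP; rewrite eq_sym -subr_eq0; apply/eqP.
have cZ := card_hyperplanes_through vv.
have rf := hyperplanes_through_row_free v.
have : row_full (rowsub (@enum_val _ (mem (hyperplanes_through B psi v))) Bm).
  by rewrite /row_full (eqP rf) cZ.
case/row_fullP => D DN; rewrite -[_ - _]mul1mx -DN -mulmxA.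
rewrite mul_rowsub_mx (_ : rowsub _ _ = 0) ?mulmx0 //.
apply/matrixP => l k; rewrite ord1 mxE affine_formB !mxE.
have := enum_valP l; have := enum_valP l; rewrite {2}Zvv' !mem_hyperplanes_through.
by move=> /eqP -> /eqP ->; rewrite subrr.
Qed.

Lemma finite_vertices (S : set 'cV[R]_m) : finite_set (vertices_in B psi S).
Proof.
have inj : {in vertices_in B psi setT &, injective (@hyperplanes_through R n m B psi)}.
  by move=> v v' /set_mem[vv _] _; apply: vertex_eq.
apply: (@sub_finite_set _ _ (vertices_in B psi setT)) => [v [] //|].
by rewrite -(eq_finite_set (inj_card_eq inj)); apply: finite_finset.
Qed.

(** * Chambers and their closures *)

Definition open_cell x : set 'cV[R]_m :=
  [set y | forall i, Num.sg (ell i y) = Num.sg (ell i x)]%classic.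

Definition off_hyperplanes x := forall i, ell i x != 0.

Definition separating x x' : {set 'I_n} := [set i | ell i x * ell i x' < 0].

Lemma affine_form_continuous i : continuous (ell i : 'cV[R]_m -> R).
Proof.
have -> : (ell i : 'cV[R]_m -> R) =
    (fun x => \sum_k (B i k)%:~R * x k 0 + (psi i 0)%:~R).
  by apply/funext => x; rewrite /affine_form !mxE; congr (_ + _);
     apply: eq_bigr => k _; rewrite mxE.
move=> x; apply: (@cvgD _ _ _ (nbhs x)); last exact: cvg_cst.
apply: cvg_big => [|k _]; first exact: add_continuous.
by apply: cvgM; [exact: cvg_cst | exact: coord_continuous].
Qed.

(** A point satisfying the weak inequalities is the limit of points of the cell
    along the segment that joins it to [x]. *)
Lemma closure_open_cell x : off_hyperplanes x ->
  closure (open_cell x) = [set y | forall i, 0 <= ell i x * ell i y]%classic.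
Proof.
move=> x0; apply/seteqP; split => y /=.
  move=> cy i.
  have cl : closed [set z : 'cV[R]_m | 0 <= ell i x * ell i z]%classic.
    apply: (@preimage_closed _ _ (fun z => ell i x * ell i z) [set t | 0 <= t]%classic).
      by move=> z _; apply: (@cvgM _ _ (nbhs z)); [exact: cvg_cst | exact: affine_form_continuous].
    exact: closed_ge.
  apply: cl; apply: closure_subset cy => z /= /(_ i) zx.
  by rewrite -sgr_ge0 sgrM zx -sgrM sgr_ge0 -expr2 sqr_ge0.
move=> yx U Uy.
have cvy : (y + t *: (x - y) @[t --> (0:R)^'+] --> y)%classic.
  apply: cvg_at_right_filter; rewrite -[X in (_ --> X)%classic]addr0 -(scale0r (x - y)).
  by apply: cvgD; [exact: cvg_cst | apply: cvgZl; exact: cvg_id].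
near (0:R)^'+%classic => t.
exists (y + t *: (x - y)); split; last by near: t; exact: cvy.
have t0 : 0 < t by near: t; exact: nbhs_right_gt.
have t1 : t < 1 by near: t; exact: nbhs_right_lt.
move=> i; rewrite affine_form_segment.
have : 0 < ell i x * ((1 - t) * ell i y + t * ell i x).
  rewrite mulrDr mulrCA [ell i x * (t * _)]mulrCA -expr2.
  apply: ltr_wpDl; first by apply: mulr_ge0 => //; rewrite subr_ge0 ltW.
  by rewrite mulr_gt0 // exprn_even_gt0 ?x0.
rewrite -sgr_gt0 sgrM.
case: (sgrP (ell i x)) (x0 i) => // _ _; rewrite ?mul1r ?mulN1r.
  by rewrite sgr_gt0; exact: gtr0_sg.
by rewrite oppr_gt0 sgr_lt0; exact: ltr0_sg.
Unshelve. all: end_near.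
Qed.

(** A set of dimension [k] gives [k] independent vectors in the kernel of [N],
    whose dimension is [m - s]. *)
Lemma affine_dim_le (S : set 'cV[R]_m) s (N : 'M[R]_(s, m)) :
  row_free N -> (forall y z, S y -> S z -> N *m (y - z) = 0) ->
  (affine_dim S + s <= m)%N.
Proof.
move=> rfN SN; have sm : (s <= m)%N by rewrite -(eqP rfN) rank_leq_col.
suff : (affine_dim S <= m - s)%N by rewrite leq_subRL // addnC.
apply/bigmax_leqP => k /asboolP[y [w [Sy Sw fw]]]; rewrite leq_subRL // addnC.
by apply: free_kernel_bound fw rfN _ => j; apply: SN.
Qed.

Lemma affine_dim_ge (S : set 'cV[R]_m) k (y : 'cV[R]_m) (w : 'I_k -> 'cV[R]_m) :
  S y -> (forall j, S (w j)) -> free [seq w j - y | j : 'I_k] ->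
  (k <= affine_dim S)%N.
Proof.
move=> Sy Sw fw.
have km : (k < m.+1)%N.
  by rewrite ltnS -(eqP (etrans (esym (free_row_free _)) fw : row_free _)) rank_leq_col.
apply: (leq_bigmax_cond (Ordinal km)).
by apply/asboolP; exists y, w.
Qed.

(** A cell on which some form vanishes lies in a hyperplane, hence is not of full
    dimension; for a zero row of [B], simplicity forces the constant form to be
    non-zero. *)
Lemma chamber_off_hyperplanes F : bounded_chamber B psi F ->
  exists2 x, off_hyperplanes x & F = open_cell x.
Proof.
move=> [[[x FE] _] dimF]; exists x => // i; apply/eqP => li0.
have rf : row_free (rowsub (fun _ : 'I_1 => i) Bm).
  by apply: (@zero_rows_free _ _ x) => // a b _; rewrite !ord1.
suff : (affine_dim F + 1 <= m)%N by rewrite dimF addn1 ltnn.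
apply: affine_dim_le rf _ => y z; rewrite FE /= => /(_ i) yi /(_ i) zi.
apply/matrixP => a b; rewrite mul_rowsub_mx mxE !ord1 affine_formB mxE.
move: yi zi; rewrite li0 sgr0 => /eqP + /eqP.
by rewrite !sgr_eq0 => /eqP -> /eqP ->; rewrite subrr.
Qed.

(** * The common face of two chambers *)

Section TwoChambers.

Variables x x' : 'cV[R]_m.
Hypotheses (x0 : off_hyperplanes x) (x'0 : off_hyperplanes x').

Let sigma := (closure (open_cell x) `&` closure (open_cell x'))%classic.

(** On the common face the form is weakly of both signs. *)
Lemma common_face_separating y i :
  sigma y -> i \in separating x x' -> ell i y = 0.
Proof.
rewrite /sigma !closure_open_cell //= => -[/(_ i) yx /(_ i) yx'].
rewrite inE => sep; apply/eqP/negPn/negP => y0.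
have := mulr_ge0 yx yx'; rewrite mulrACA -expr2 leNgt => /negP; apply.
by rewrite nmulr_rlt0 // exprn_even_gt0.
Qed.

Lemma separating_sub v :
  sigma v -> separating x x' \subset hyperplanes_through B psi v.
Proof.
move=> sv; apply/fintype.subsetP => i si.
by rewrite mem_hyperplanes_through common_face_separating.
Qed.

Lemma sgr_separating i :
  Num.sg (ell i x') = (if i \in separating x x' then -1 else 1) * Num.sg (ell i x).
Proof.
have := x0 i; have := x'0 i; rewrite inE -sgr_lt0 sgrM.
by case: (sgrP (ell i x)) => // _; case: (sgrP (ell i x')) => // _ _ _;
   rewrite ?mulr1 ?mul1r ?(mulrN1, opprK) ?ltrN10 ?ltr10 ?opprK.
Qed.

(** The upper bound comes from the [#sep] independent equations valid on the common
    face.  For the lower bound, the basis dual to the normals at [v] provides, for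
    each non-separating hyperplane through [v], a direction in which its form takes
    the sign common to both chambers while the other forms vanishing at [v] stay
    zero; a small step in this direction remains in the common face. *)
Lemma affine_dim_common_face v : cell B psi [set v] -> sigma v ->
  affine_dim sigma = (m - #|separating x x'|)%N.
Proof.
move=> vv sv.
have sepZ := separating_sub sv; have cZ := card_hyperplanes_through vv.
pose Z := hyperplanes_through B psi v.
have sm : (#|separating x x'| <= m)%N by rewrite -cZ subset_leq_card.
apply/eqP; rewrite eqn_leq; apply/andP; split.
  rewrite leq_subRL // addnC.
  apply: (@affine_dim_le _ _ (rowsub (@enum_val _ (mem (separating x x'))) Bm)).
    apply: (@zero_rows_free _ _ v) => [|l]; first exact: enum_val_inj.
    by apply: common_face_separating => //; apply: enum_valP.
  move=> y z sy sz; apply/matrixP => l b.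
  rewrite mul_rowsub_mx mxE !ord1 affine_formB mxE.
  by rewrite !common_face_separating ?subrr ?enum_valP.
have /row_freeP[D ND] := hyperplanes_through_row_free v.
pose P := Z :\: separating x x'.
have cP : #|P| = (m - #|separating x x'|)%N.
  by rewrite cardsD (finset.setIidPr sepZ) cZ.
have PZ (j : 'I_#|P|) : enum_val j \in Z by have := enum_valP j; rewrite inE => /andP[].
(* D is dual to the normals at v; the sign makes the direction point inwards. *)
pose u j := Num.sg (ell (enum_val j) x) *: col (enum_rank_in (PZ j) (enum_val j)) D.
have BuE (j : 'I_#|P|) i : i \in Z ->
    (Bm *m u j) i 0 = Num.sg (ell i x) * (i == enum_val j)%:R.
  move=> iZ; rewrite -scalemxAr mxE.
  have /matrixP/(_ (enum_rank_in iZ i) (enum_rank_in (PZ j) (enum_val j))) := ND.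
  rewrite mul_rowsub_mx mxE enum_rankK_in // => BDE.
  rewrite -[(Bm *m _) i 0](_ : (Bm *m D) i (enum_rank_in (PZ j) (enum_val j)) = _); last first.
    by rewrite !mxE; apply: eq_bigr => k _; rewrite !mxE.
  rewrite BDE !mxE -(inj_eq enum_val_inj) !enum_rankK_in //.
  by case: eqP => [->|]; rewrite ?mulr0.
pose e j := sval (cid2 (small_step v (u j))).
have e0 j : 0 < e j by rewrite /e; case: (cid2 _).
have he j i : ell i v != 0 -> Num.sg (ell i (v + e j *: u j)) = Num.sg (ell i v).
  by rewrite /e; case: (cid2 _) => /= ? _; apply.
rewrite -cP; apply: (@affine_dim_ge _ _ v (fun j => v + e j *: u j)) => // [j|].
  rewrite /sigma !closure_open_cell //=; move: (sv).
  rewrite /sigma !closure_open_cell //= => -[vx vx'].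
  suff ge0 i : 0 <= ell i x * ell i (v + e j *: u j) /\
               0 <= ell i x' * ell i (v + e j *: u j) by split=> i; case: (ge0 i).
  have [li0|li0] := eqVneq (ell i v) 0; last first.
    by split; rewrite -sgr_ge0 sgrM he // -sgrM sgr_ge0.
  have iZ : i \in Z by rewrite mem_hyperplanes_through li0.
  rewrite affine_formD li0 add0r -scalemxAr mxE BuE //.
  have [iE|] := eqVneq i (enum_val j); last by rewrite !mulr0.
  have := enum_valP j; rewrite -iE inE => /andP[ns _].
  have sg' := sgr_separating i; rewrite (negPf ns) mul1r in sg'.
  have pos z : 0 <= z * (e j * Num.sg z).
    by rewrite mulrCA [z * _]mulrC -normrEsg mulr_ge0 // ltW.
  by rewrite mulr1; split; rewrite // -sg'.
rewrite free_row_free; apply: inj_row_free => c cW; apply/rowP => j.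
have /matrixP/(_ 0 (enum_val j)) : c *m (\matrix_(a, b) (v + e a *: u a - v) b 0) *m Bm^T = 0.
  by rewrite cW mul0mx.
have WE a : (\matrix_(a, b) (v + e a *: u a - v) b 0 *m Bm^T) a (enum_val j) =
    e a * (Num.sg (ell (enum_val j) x) * (j == a)%:R).
  rewrite -(inj_eq enum_val_inj) -BuE // !mxE mulr_sumr; apply: eq_bigr => b _.
  by rewrite !mxE [v b 0 + _]addrC addrK -[LHS]mulrA; congr (_ * _); apply: mulrC.
rewrite -mulmxA mxE (bigD1 j) //= big1 => [|a aj]; last first.
  by rewrite WE eq_sym (negPf aj) !mulr0.
rewrite addr0 WE eqxx mulr1 !mxE => /eqP.
by rewrite !mulf_eq0 (gt_eqF (e0 j)) sgr_eq0 (negPf (x0 _)) !orbF => /eqP.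
Qed.

End TwoChambers.

(** No hyperplane meets the open chamber, whereas [m > 0] of them pass through each
    vertex; so all vertices of the closure are on the boundary. *)
Lemma vertices_in_boundary x : (0 < m)%N -> off_hyperplanes x ->
  vertices_in B psi (boundary (open_cell x)) =
  vertices_in B psi (closure (open_cell x)).
Proof.
move=> m0 x0; apply/seteqP; split => v [vv /= cv]; split => //.
  by case: cv.
split=> // /interior_subset /= vx.
have := card_hyperplanes_through vv; rewrite (_ : hyperplanes_through _ _ _ = finset.set0).
  by rewrite cards0 => mE; rewrite -mE in m0.
apply/setP => i; rewrite mem_hyperplanes_through !inE -sgr_eq0 vx sgr_eq0.
exact: negPf.
Qed.

Lemma inward_normal_open_cell x i : off_hyperplanes x ->
  inward_normal B psi (open_cell x) i = Num.sg (ell i x) *: (row i Bm)^T.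
Proof.
move=> x0; rewrite /inward_normal; have := x0 i; rewrite neq_lt => /orP[xi|xi].
  rewrite asboolF ?ltr0_sg ?scaleN1r // => /(_ x); rewrite ltNge ltW // => pos.
  by have := pos (fun=> erefl).
rewrite asboolT ?gtr0_sg ?scale1r // => y /(_ i).
by rewrite (gtr0_sg xi) => /eqP; rewrite sgr_cp0.
Qed.

(** * Inner products of vertex chains *)

Section Orientation.

Variable o : simplex R B psi m -> m.-tuple 'I_n.
Hypotheses (oP : is_orientation o) (m_gt0 : (0 < m)%N).

Lemma hyperplanes_through_simplex v : cell B psi [set v] ->
  exists s : simplex R B psi m, val s = hyperplanes_through B psi v.
Proof.
move=> vv.
have Zs : (hyperplanes_through B psi v \in nerve R B psi) &&
          (#|hyperplanes_through B psi v| == m).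
  rewrite card_hyperplanes_through // eqxx andbT; apply/mem_set; split.
    by rewrite -card_gt0 card_hyperplanes_through.
  split; first by apply/fintype.subsetP => i; rewrite inE => /andP[].
  by exists v => i; rewrite mem_hyperplanes_through => /eqP.
by exists (Sub (hyperplanes_through B psi v) Zs); rewrite SubK.
Qed.

Lemma oriented_simplex_eq0 (t : m.-tuple 'I_n) (s : simplex R B psi m) :
  val s != [set i in t]%SET -> oriented_simplex o t s = 0.
Proof.
move=> st; rewrite ffunE big_pred0 // => g; apply: contraNF st => /forallP tg.
rewrite -oP; apply/eqP/setP => i; rewrite !inE.
apply/tnthP/tnthP => -[k ->]; first by exists ((g^-1)%g k); rewrite (eqP (tg _)) permKV.
by exists (g k); apply/eqP.
Qed.

(** Both [t] and the reference ordering list the same vertices without repetition,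
    so a single permutation contributes, and the only non-zero coordinate is its
    signature. *)
Lemma oriented_simplex_norm (t : m.-tuple 'I_n) (s : simplex R B psi m) :
  uniq t -> val s = [set i in t]%SET ->
  chain_dot (oriented_simplex o t) (oriented_simplex o t) = 1.
Proof.
move=> ut st; rewrite /chain_dot (bigD1 s) //= big1 => [|s' ns]; last first.
  by rewrite oriented_simplex_eq0 ?mul0r // -st.
have pto : perm_eq t (o s).
  have eqto : t =i o s by move=> i; have /setP/(_ i) := oP s; rewrite st !inE => ->.
  apply: uniq_perm => //; apply/card_uniqP.
  by rewrite -(eq_card eqto) (card_uniqP ut) !size_tuple.
have uo : uniq (o s) by rewrite -(perm_uniq pto).
have /tuple_permP[g tg] := pto.
have tgk k : tnth t k = tnth (o s) (g k).
  by rewrite (tnth_nth (tnth t k)) tg -tnth_nth tnth_mktuple.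
rewrite addr0 ffunE (big_pred1 g) => [|h /=]; first by rewrite -expr2 sqrr_sign.
apply/forallP/eqP => [th|-> k]; last by rewrite tgk.
apply/permP => k; apply/(tuple_uniqP _ uo).
by rewrite -tgk (eqP (th k)).
Qed.

(** The part of the determinant that depends on the chamber is separated from the
    part that depends only on the vertex: the inward frame is the frame of the rows
    of [B] times the diagonal matrix of the signs of the forms on the chamber. *)
Lemma Psi_vertexE x v : off_hyperplanes x -> cell B psi [set v] ->
  exists t : m.-tuple 'I_n,
    tval t = enum (hyperplanes_through B psi v) /\
    Psi_vertex o (open_cell x) v = oriented_simplex o t *~
      sgz (\det (rowsub (tnth t) Bm) * \prod_(l < m) Num.sg (ell (tnth t l) x)).
Proof.
move=> x0 vv; rewrite /Psi_vertex; case: insubP => [t _ tE|]; last first.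
  by rewrite -cardE card_hyperplanes_through ?eqxx.
exists t; split=> //; congr (_ *~ sgz _).
rewrite -[\det (rowsub _ _)]det_tr.
have -> : \prod_(l < m) Num.sg (ell (tnth t l) x) =
          \det (diag_mx (\row_l Num.sg (ell (tnth t l) x))).
  by rewrite det_diag; apply: eq_bigr => l _; rewrite mxE.
rewrite -det_mulmx; congr (\det _); apply/matrixP => k l.
rewrite mul_mx_diag !mxE inward_normal_open_cell // !mxE. exact: mulrC.
Qed.

(** For distinct vertices the supporting simplices differ.  For [v = v'] the square
    of the determinant of the rows at [v] is positive, and the quotient of the two
    diagonal sign matrices has an entry [-1] exactly at each separating
    hyperplane. *)
Lemma Psi_vertex_dot x x' v v' :
  off_hyperplanes x -> off_hyperplanes x' ->
  vertices_in B psi (closure (open_cell x)) v ->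
  vertices_in B psi (closure (open_cell x')) v' ->
  chain_dot (Psi_vertex o (open_cell x) v) (Psi_vertex o (open_cell x') v') =
  if v == v' then (-1) ^+ #|separating x x'| else 0.
Proof.
move=> x0 x'0 [vv cv] [vv' cv'].
have [t [tE ->]] := Psi_vertexE x0 vv.
have [t' [t'E ->]] := Psi_vertexE x'0 vv'.
have dotMz (c c' : chain R B psi m) a b : chain_dot (c *~ a) (c' *~ b) = chain_dot c c' * (a * b).
  rewrite /chain_dot mulr_suml; apply: eq_bigr => s _.
  by rewrite !ffunMzE !mulrzz mulrACA.
rewrite dotMz -sgzM mulrACA.
have [vv'E|vv'E] := eqVneq v v'; last first.
  rewrite /chain_dot big1 ?mul0r // => s _.
  have [sZ|] := eqVneq (val s) [set i in t]%SET; last first.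
    by move/oriented_simplex_eq0 => ->; rewrite mul0r.
  rewrite [X in _ * X]oriented_simplex_eq0 ?mulr0 // sZ.
  apply: contra_neq vv'E => tt'; apply: (vertex_eq vv); apply/setP => i.
  by have /setP/(_ i) tti := tt'; rewrite !inE !memtE tE t'E !mem_enum in tti.
subst v'; have {t' t'E}-> : t' = t by apply: val_inj; rewrite /= tE t'E.
have [s sE] := hyperplanes_through_simplex vv.
have tZ i : (i \in t) = (i \in hyperplanes_through B psi v).
  by rewrite memtE tE mem_enum.
have ut : uniq t by rewrite tE enum_uniq.
rewrite (oriented_simplex_norm (s := s)) //; last first.
  by rewrite sE; apply/setP => i; rewrite [RHS]inE tZ.
have sepZ : separating x x' \subset hyperplanes_through B psi v.
  by apply: separating_sub.
have -> : \prod_(l < m) Num.sg (ell (tnth t l) x) *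
          \prod_(l < m) Num.sg (ell (tnth t l) x') =
          (-1) ^+ #|separating x x'|.
  rewrite -big_split /=.
  rewrite (eq_bigr (fun l => if tnth t l \in separating x x' then -1 else 1)); last first.
    by move=> l _; rewrite (sgr_separating x0 x'0) mulrCA -expr2 sqr_sg x0 mulr1.
  rewrite -(big_tuple _ _ t xpredT (fun i => if i \in separating x x' then -1 else 1)).
  rewrite tE big_enum -big_mkcondr /=.
  rewrite (eq_bigl (mem (separating x x'))) ?prodr_const // => i.
  by rewrite andbC; apply/andb_idr; apply: (fintype.subsetP sepZ).
have det0 : \det (rowsub (tnth t) Bm) != 0.
  rewrite -unitfE -[_ \is a _]/(rowsub (tnth t) Bm \in unitmx) -row_free_unit.
  apply: (@zero_rows_free _ _ v) => [|l]; first exact/tuple_uniqP.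
  by apply/eqP; rewrite -mem_hyperplanes_through -tZ mem_tnth.
by rewrite mul1r sgzM gtr0_sgz -?expr2 ?exprn_even_gt0 // mul1r sgzX sgzN1.
Qed.

Lemma chain_dot_sum (X Y : seq 'cV[R]_m) (f g : 'cV[R]_m -> chain R B psi m) :
  chain_dot (\sum_(v <- X) f v) (\sum_(v' <- Y) g v') =
  \sum_(v <- X) \sum_(v' <- Y) chain_dot (f v) (g v').
Proof.
rewrite /chain_dot; under eq_bigr => s _ do rewrite !sum_ffunE mulr_suml.
rewrite exchange_big; apply: eq_bigr => v _ /=.
by rewrite exchange_big; apply: eq_bigr => s _ /=; rewrite mulr_sumr.
Qed.

Lemma vertices_inI (S S' : set 'cV[R]_m) :
  vertices_in B psi (S `&` S') = (vertices_in B psi S `&` vertices_in B psi S')%classic.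
Proof.
by apply/seteqP; split => v [] => [cv [Sv S'v]|[cv Sv] [_ S'v]].
Qed.

Lemma Psi_dot x x' : off_hyperplanes x -> off_hyperplanes x' ->
  chain_dot (Psi o (open_cell x)) (Psi o (open_cell x')) =
  (-1) ^+ #|separating x x'| *
  (#|` fset_set (vertices_in B psi
        (closure (open_cell x) `&` closure (open_cell x')))|)%:Z.
Proof.
move=> x0 x'0; rewrite /Psi !vertices_in_boundary //.
have fin S := finite_vertices S.
rewrite vertices_inI (fset_setI (fin _) (fin _)).
set X := fset_set _; set Y := fset_set _.
have XP v : v \in X -> vertices_in B psi (closure (open_cell x)) v.
  by rewrite in_fset_set // => /set_mem.
have YP v : v \in Y -> vertices_in B psi (closure (open_cell x')) v.
  by rewrite in_fset_set // => /set_mem.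
rewrite chain_dot_sum.
rewrite (eq_big_seq (fun v => if v \in Y then (-1) ^+ #|separating x x'| else 0)); last first.
  move=> v /XP Xv.
  rewrite (eq_big_seq (fun v' => if v == v' then (-1) ^+ #|separating x x'| else 0)); last first.
    by move=> v' /YP; apply: Psi_vertex_dot.
  case: ifPn => vY.
    rewrite (bigD1_seq v) ?fset_uniq //= eqxx big1 ?addr0 // => v' v'v.
    by rewrite eq_sym (negPf v'v).
  rewrite big_seq big1 // => v' v'Y.
  by case: eqP => // vv'; rewrite vv' v'Y in vY.
rewrite -big_mkcond -big_filter big_const_seq count_predT iter_addr_0 -mulr_natr natz.
congr (_ * Posz _); apply/perm_size/uniq_perm; rewrite ?filter_uniq ?fset_uniq // => v.
by rewrite mem_filter in_fsetI andbC.
Qed.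

End Orientation.

(** Here [(-1) ^ (m - #sep)] is rewritten as [(-1) ^ m (-1) ^ #sep]; a
    face without vertices contributes zero to both sides. *)
Lemma Phi_open_cell x x' : off_hyperplanes x -> off_hyperplanes x' ->
  Phi B psi (open_cell x) (open_cell x') =
  (-1) ^+ m * ((-1) ^+ #|separating x x'| *
  (#|` fset_set (vertices_in B psi
        (closure (open_cell x) `&` closure (open_cell x')))|)%:Z).
Proof.
move=> x0 x'0; rewrite /Phi mulrA -exprD.
set V := fset_set _; have [->|[v]] := fset_0Vmem V; first by rewrite cardfs0 !mulr0.
rewrite in_fset_set; last exact: finite_vertices.
move=> /set_mem[vv sv]; congr (_ * _).
rewrite (affine_dim_common_face x0 x'0 vv sv).
have sm : (#|separating x x'| <= m)%N.
  by rewrite -(card_hyperplanes_through vv) subset_leq_card // separating_sub.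
by rewrite -{2}(subnK sm) -addnA exprD addnn -[X in _ * X]signr_odd odd_double mulr1.
Qed.

End SimpleArrangement.

(** * Generic degrees give simple arrangements *)

Section Genericity.

Variables (R : realType) (d n m : nat).
Variables (A : 'M[int]_(d, n)) (B : 'M[int]_(n, m)).

Lemma mulmx_lift p q k (M : 'M[int]_(p, q)) (P : 'M[int]_(p, k)) :
  (forall j, exists y : 'cV_q, M *m y = col j P) -> exists Y, M *m Y = P.
Proof.
case/choice => y yP; exists (\matrix_(i, j) y j i 0).
apply/matrixP => i j; have /colP/(_ i) := yP j; rewrite !mxE => <-.
by apply: eq_bigr => l _; rewrite mxE.
Qed.

(** The splitting is made of integer matrices satisfying polynomial identities, so
    it carries over to the reals, unlike exactness itself. *)
Lemma short_exact_splitting : short_exact B A ->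
  A *m B = 0 /\ exists C D, C *m A + B *m D = 1%:M.
Proof.
move=> [_ exA surjA].
have AB0 : A *m B = 0.
  apply/matrixP => i j; have /colP/(_ i) : A *m (B *m delta_mx j 0) = 0 :> 'cV_d.
    by apply/exA; exists (delta_mx j 0).
  by rewrite mulmxA -colE !mxE.
have [C AC] : exists C, A *m C = 1%:M by apply: mulmx_lift => j; apply: surjA.
split=> //; have [D BD] : exists D, B *m D = 1%:M - C *m A.
  apply: mulmx_lift => j.
  have /exA[x ->] : A *m col j (1%:M - C *m A) = 0; last by exists x.
  by rewrite colE mulmxA mulmxBr mulmx1 mulmxA AC mul1mx subrr mul0mx.
by exists C, D; rewrite BD addrC subrK.
Qed.

(** If [w] were non-zero, the columns [a_j] with [z_j <> 0] would have rank less
    than [d], and a maximal independent family among them would express [theta]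
    with fewer than [d] columns. *)
Lemma generic_span (theta : 'cV[int]_d) (z : 'cV[R]_n) (w : 'rV[R]_d) :
  generic_degree R A theta -> map_mx intr A *m z = map_mx intr theta ->
  (forall j, z j 0 != 0 -> (w *m map_mx intr A) 0 j = 0) -> w = 0.
Proof.
move=> [_ gen] Az wA; apply/eqP/negPn/negP => w0.
(* The relevant columns of A as rows, zero rows elsewhere to keep the indices. *)
pose M : 'M[R]_(n, d) := \matrix_(j, k) (if z j 0 != 0 then (A k j)%:~R else 0).
have Mw : M *m w^T = 0.
  apply/colP => j; rewrite !mxE; have [zj|zj] := eqVneq (z j 0) 0.
    by rewrite big1 // => k _; rewrite !mxE zj eqxx mul0r.
  apply: etrans (wA j zj); rewrite !mxE; apply: eq_bigr => k _.
  by rewrite !mxE zj mulrC.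
have rM : (\rank M < d)%N.
  rewrite ltn_neqAle rank_leq_col andbT; apply: contra_neqN w0 => fullM.
  have /row_fullP[L LM] : row_full M by [].
  by apply: trmx_inj; rewrite -[w^T]mul1mx -LM -mulmxA Mw mulmx0 trmx0.
have thM : ((map_mx intr theta)^T <= rowsub (maxrankfun M) M)%MS.
  rewrite eq_maxrowsub; apply/submxP; exists z^T; apply: trmx_inj.
  rewrite trmxK trmx_mul trmxK -Az; apply/colP => k; rewrite !mxE.
  apply: eq_bigr => j _; rewrite !mxE.
  by have [->|//] := eqVneq (z j 0) 0; rewrite !mulr0.
have [c thE] := submxP thM.
pose J : {set 'I_n} := [set maxrankfun M l | l in 'I_(\rank M)]%SET.
apply: (gen J); first by rewrite card_imset ?card_ord //; apply: maxrankfun_inj.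
(* The sum has at most one term: maxrankfun M is injective. *)
exists (fun j => (\sum_(l | maxrankfun M l == j) c 0 l) * (z j 0 != 0)%:R).
rewrite big_imset /=; last by move=> ? ? _ _; apply: maxrankfun_inj.
apply: trmx_inj; rewrite thE; apply/rowP => k; rewrite !mxE summxE.
apply: eq_bigr => l _; rewrite !mxE (big_pred1 l) => [|l' /=]; last first.
  by rewrite (inj_eq (@maxrankfun_inj _ _ _ M)).
by case: ifP; rewrite ?mulr1 // !mulr0 mul0r.
Qed.

(** The splitting turns a relation [c B = 0] into [c = (c C) A], and [c C] kills
    the columns of [A] off the hyperplanes through [v]. *)
Lemma generic_simple (theta : 'cV[int]_d) (psi : 'cV[int]_n) :
  short_exact B A -> generic_degree R A theta -> A *m psi = theta ->
  simple_arrangement R B psi.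
Proof.
move=> /short_exact_splitting[AB0 [C [D CD]]] gen Apsi v c cB cZ.
have cE : c = c *m map_mx intr C *m map_mx intr A.
  rewrite -[LHS]mulmx1 -(map_mx1 (intr : int -> R)) -CD map_mxD !map_mxM.
  by rewrite mulmxDr !mulmxA cB mul0mx addr0.
rewrite cE (_ : c *m _ = 0) ?mul0mx //.
apply: (generic_span (z := map_mx intr B *m v + map_mx intr psi) gen).
  by rewrite mulmxDr mulmxA -!map_mxM AB0 map_mx0 mul0mx add0r Apsi.
by move=> j zj; rewrite -cE; apply: cZ.
Qed.

End Genericity.

Theorem proposition5 (R : realType) (d n : nat) (hdn : (d < n)%N)
    (A : 'M[int]_(d, n)) (hA : coprime_maximal_minors A)
    (theta : 'cV[int]_d) (htheta : smooth_degree R A theta)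
    (B : 'M[int]_(n, n - d)) (hB : short_exact B A)
    (psi : 'cV[int]_n) (hpsi : A *m psi = theta)
    (o : simplex R B psi (n - d)%N -> (n - d)%N.-tuple 'I_n)
    (ho : is_orientation o)
    (Fi : set 'cV[R]_(n - d)) (hFi : bounded_chamber B psi Fi)
    (Fj : set 'cV[R]_(n - d)) (hFj : bounded_chamber B psi Fj) :
  Phi B psi Fi Fj = (-1) ^+ (n - d) * chain_dot (Psi o Fi) (Psi o Fj).
Proof.
have simple := generic_simple hB htheta.1 hpsi.
have [x x0 ->] := chamber_off_hyperplanes simple hFi.
have [x' x'0 ->] := chamber_off_hyperplanes simple hFj.
by rewrite Psi_dot ?subn_gt0 // Phi_open_cell.
Qed.
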